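(* Let $X$ be a real Banach space. If $X^{\#}$ has the approximation property, then $X$ has the Lipschitz approximation property.
   Context: $Lip_0(X,Y)$ is the space of Lipschitz maps $f:X\to Y$ with $f(0)=0$, and $X^{\#}=Lip_0(X,\mathbb{R})$ is a Banach space under the norm given by the best Lipschitz constant. $Lip_{0\mathcal{F}}(X,X)$ is the set of $f\in Lip_0(X,X)$ whose range spans a finite-dimensional subspace. $\tau_c$ is the topology of uniform convergence on compact subsets. A Banach space $E$ has the approximation property if $Id_E$ lies in the $\tau_c$-closure of the bounded finite-rank linear operators on $E$; $X$ has the Lipschitz approximation property if $Id_X\in\overline{Lip_{0\mathcal{F}}(X,X)}^{\tau_c}$. *)

(* Defs.v *)
From HB Require Import structures.
From mathcomp Require Import all_boot all_order all_algebra.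
From mathcomp Require Import all_classical all_reals all_analysis.
From mathcomp Require Import ring.

Set Implicit Arguments.
Unset Strict Implicit.
Unset Printing Implicit Defensive.

Import Order.TTheory GRing.Theory Num.Theory.
Import numFieldNormedType.Exports.

Local Open Scope classical_set_scope.
Local Open Scope ring_scope.

Section FiniteDimension.
Context {R : realType} {V : lmodType R}.

Definition lin_span (A : set V) : set V :=
  [set v | exists n (a : 'I_n -> R) (x : 'I_n -> V),
     (forall i, A (x i)) /\ v = \sum_(i < n) a i *: x i].

Definition finite_dimensional (S : set V) :=
  exists n (b : 'I_n -> V), S = lin_span (range b).

End FiniteDimension.

Definition Lip0 (R : realType) (X Y : normedModType R) : set (X -> Y) :=
  [set f | lipschitz f /\ f 0 = 0].
Arguments Lip0 {R} X Y _.

Definition Lip0F (R : realType) (X Y : normedModType R) : set (X -> Y) :=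
  [set f | Lip0 X Y f /\ finite_dimensional (lin_span (range f))].
Arguments Lip0F {R} X Y _.

(* The sign condition on the constants only matters when X is trivial. *)
Definition lip_const (R : realType) (X Y : normedModType R) (f : X -> Y) : R :=
  inf [set k | 0 <= k /\ k.-lipschitz f].

Section BestLipschitzConstant.
Context {R : realType} {X Y : normedModType R}.
Implicit Types f g : X -> Y.

Lemma lip0_const_nonempty f : Lip0 X Y f ->
  [set k : R | 0 <= k /\ k.-lipschitz f] !=set0.
Proof.
case=> /pinfty_ex_gt0[k k0 fk] _; exists k; split; first exact: ltW.
exact: fk.
Qed.

Lemma lip_const_ge0 f : Lip0 X Y f -> 0 <= lip_const f.
Proof.
by move=> /lip0_const_nonempty f0; apply: lb_le_inf => // k [].
Qed.

Lemma lip_const_le f k : 0 <= k ->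
  (forall x y, `|f x - f y| <= k * `|x - y|) -> lip_const f <= k.
Proof.
move=> k0 fk; apply: ge_inf; first by exists 0 => ? [].
by split=> // -[x y] _; exact: fk.
Qed.

Lemma lip_constP f x y : Lip0 X Y f -> `|f x - f y| <= lip_const f * `|x - y|.
Proof.
move=> /lip0_const_nonempty f0; have [->|xy] := eqVneq x y.
  by rewrite !subrr !normr0 mulr0.
have xy0 : 0 < `|x - y| by rewrite normr_gt0 subr_eq0.
rewrite -ler_pdivrMr//; apply: lb_le_inf => // k [k0 fk].
by rewrite ler_pdivrMr//; exact: (fk (x, y)).
Qed.

Lemma Lip0_intro f k : f 0 = 0 ->
  (forall x y, `|f x - f y| <= k * `|x - y|) -> Lip0 X Y f.
Proof.
move=> f0 fk; split=> //.
apply: (@klipschitzW _ _ _ k); first exact: (@globally_properfilter _ _ (0, 0)).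
by move=> [x y] _; exact: fk.
Qed.

End BestLipschitzConstant.

Definition lip0_pred (R : realType) (X : normedModType R) : {pred X -> R^o} :=
  mem (Lip0 X R^o).
Arguments lip0_pred {R} X.

Record lip_dual (R : realType) (X : normedModType R) := LipDual {
  lip_dual_fun :> X -> R^o;
  lip_dual_subproof : lip_dual_fun \in lip0_pred X
}.

HB.instance Definition _ (R : realType) (X : normedModType R) :=
  [isSub of lip_dual X for @lip_dual_fun R X].
HB.instance Definition _ (R : realType) (X : normedModType R) :=
  [Choice of lip_dual X by <:].

Section LipDualNormed.
Context {R : realType} {X : normedModType R}.
Local Notation D := (lip_dual X).
Implicit Types f g : D.

Lemma lip0_submod_closed : submod_closed (lip0_pred X).
Proof.
split.
  apply/mem_set/(@Lip0_intro _ _ _ _ 0) => // x y.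
  by rewrite subrr normr0 mul0r.
move=> a f g /set_mem fL /set_mem gL; apply/mem_set.
apply: (@Lip0_intro _ _ _ _ (`|a| * lip_const f + lip_const g)).
  case: fL gL => _ f0 [_ g0].
  by rewrite -[LHS]/(a *: f 0 + g 0) f0 g0 scaler0 addr0.
move=> x y; rewrite -[leLHS]/(`|(a *: f x + g x) - (a *: f y + g y)|).
rewrite opprD addrACA -scalerBr.
rewrite (le_trans (ler_normD _ _))// mulrDl lerD ?lip_constP//.
by rewrite normrZ -mulrA ler_wpM2l// lip_constP.
Qed.

HB.instance Definition _ := GRing.isSubmodClosed.Build R (X -> R^o)
  (lip0_pred X) lip0_submod_closed.
HB.instance Definition _ := [SubChoice_isSubLmodule of D by <:].

Lemma lip_dualP f : Lip0 X R^o f.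
Proof. exact: set_mem (lip_dual_subproof f). Qed.

Lemma lip_dualD f g x : (f + g) x = f x + g x. Proof. by []. Qed.
Lemma lip_dualN f x : (- f) x = - f x. Proof. by []. Qed.
Lemma lip_dualB f g x : (f - g) x = f x - g x. Proof. by []. Qed.
Lemma lip_dualZ (a : R) f x : (a *: f) x = a * f x. Proof. by []. Qed.
Lemma lip_dual_0 f : f 0 = 0. Proof. by case: (lip_dualP f). Qed.

Let norm f : R := lip_const f.

Let ler_norm_lipD f g : norm (f + g) <= norm f + norm g.
Proof.
apply: lip_const_le => [|x y].
  by rewrite addr_ge0// lip_const_ge0//; exact: lip_dualP.
rewrite !lip_dualD opprD addrACA mulrDl (le_trans (ler_normD _ _))//.
by rewrite lerD// lip_constP//; exact: lip_dualP.
Qed.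

Let norm_lipZ_le (a : R) f : norm (a *: f) <= `|a| * norm f.
Proof.
apply: lip_const_le => [|x y].
  by rewrite mulr_ge0// lip_const_ge0//; exact: lip_dualP.
rewrite !lip_dualZ -mulrBr normrM -mulrA ler_wpM2l// lip_constP//.
exact: lip_dualP.
Qed.

Let norm_lipZ (a : R) f : norm (a *: f) = `|a| * norm f.
Proof.
apply/eqP; rewrite eq_le norm_lipZ_le /=.
have [->|a0] := eqVneq a 0.
  by rewrite normr0 mul0r lip_const_ge0//; exact: lip_dualP.
rewrite -ler_pdivlMl ?normr_gt0// -normfV.
by rewrite -{1}[f](scalerK a0) norm_lipZ_le.
Qed.

Let norm_lip0_eq0 f : norm f = 0 -> f = 0.
Proof.
move=> f0; apply/val_inj/funext => x /=.
have := lip_constP x 0 (lip_dualP f); rewrite -/(norm f) f0 mul0r normr_le0.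
by rewrite lip_dual_0 subr0 => /eqP.
Qed.

HB.instance Definition _ := Lmodule_isNormed.Build R D
  ler_norm_lipD norm_lipZ norm_lip0_eq0.

Lemma lip_dual_normE f : `|f| = lip_const f. Proof. by []. Qed.

Lemma lip_dual_normP f x y : `|f x - f y| <= `|f| * `|x - y|.
Proof. exact: lip_constP (lip_dualP f). Qed.

Lemma lip_dual_complete (F : set_system D) :
  ProperFilter F -> cauchy F -> cvg F.
Proof.
move=> PF /cauchy_ballP Fc.
have {}Fc e : 0 < e -> \forall f \near F, \forall g \near F, `|f - g| < e.
  by move=> /Fc/nearP_dep.
have Fx (x : X) : cvg ((f : D) x @[f --> F]).
  apply: R_complete; apply/cauchy_exP => e e0.
  have d0 : 0 < e / (`|x| + 1) by rewrite divr_gt0// ltr_wpDl.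
  have [f fe] := filter_ex (Fc _ d0); exists (f x).
  apply: filterS fe => g fg; rewrite /= -ball_normE /ball_/=.
  have := lip_dual_normP (f - g) x 0.
  rewrite lip_dual_0 !subr0 lip_dualB => /le_lt_trans; apply.
  rewrite (@le_lt_trans _ _ (`|f - g| * (`|x| + 1)))// ?ler_wpM2l ?lerDl//.
  by rewrite -ltr_pdivlMr ?ltr_wpDl.
pose G (x : X) : R^o := lim ((f : D) x @[f --> F]).
have Gc x : (f : D) x @[f --> F] --> G x by exact: Fx.
have lipG (f : D) k : (\forall g \near F, `|f - g| <= k) ->
    forall x y, `|(f x - G x) - (f y - G y)| <= k * `|x - y|.
  move=> fk x y.
  have cv : `|(f x - (g : D) x) - (f y - g y)| @[g --> F] -->
      `|(f x - G x) - (f y - G y)|.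
    by apply: cvg_norm; apply: cvgB; apply: cvgB => //; exact: cvg_cst.
  rewrite -(cvg_lim _ cv)//; apply: limr_le; first by apply/cvg_ex; eexists; exact: cv.
  near=> g.
  rewrite (le_trans (lip_dual_normP (f - g) x y))// ler_wpM2r//.
  by near: g.
have [f0 f0k] : exists f0 : D, \forall g \near F, `|f0 - g| <= 1.
  have /Fc := @ltr01 R => /filter_ex[f0 h]; exists f0.
  by apply: filterS h => g /ltW.
have G0 : G 0 = 0.
  by apply: cvg_lim => //; under eq_fun do rewrite lip_dual_0; exact: cvg_cst.
have GL : Lip0 X R^o G.
  apply: (@Lip0_intro _ _ _ _ (1 + `|f0|)) => // x y.
  rewrite -normrN.
  have -> : - (G x - G y) = ((f0 x - G x) - (f0 y - G y)) - (f0 x - f0 y).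
    by ring.
  rewrite (le_trans (ler_normB _ _))// mulrDl lerD//; first exact: lipG.
  exact: lip_dual_normP.
pose g : D := LipDual (mem_set GL).
apply/cvg_ex; exists g; apply/cvgrPdist_le => e e0.
have /Fc := e0; apply: filterS => f fe.
rewrite distrC; apply: lip_const_le; first exact: ltW.
move=> x y; rewrite !lip_dualB; apply: lipG.
by apply: filterS fe => h /ltW.
Unshelve. all: by end_near. Qed.

HB.instance Definition _ := Uniform_isComplete.Build D lip_dual_complete.

End LipDualNormed.


Definition bounded_finite_rank (R : realType) (E : normedModType R) :
    set (E -> E) :=
  [set T : E -> E | exists L : {linear E -> E},
     [/\ T = L :> (E -> E),
         exists M : R, forall x, `|L x| <= M * `|x| &
         finite_dimensional (range L)]].
Arguments bounded_finite_rank {R} E _.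

(* {family compact, U -> V} carries the topology of uniform convergence on
   compact subsets of U, on the space of all maps U -> V. *)
Definition tau_c_closure (R : realType) (U V : normedModType R)
    (A : set (U -> V)) : set (U -> V) :=
  closure (A : set {family compact, U -> V}).

Definition approximation_property (R : realType)
    (E : completeNormedModType R) : Prop :=
  tau_c_closure (bounded_finite_rank E) id.

Definition lipschitz_approximation_property (R : realType)
    (X : completeNormedModType R) : Prop :=
  tau_c_closure (Lip0F X X) id.

(* Main.v *)
Require Import Defs.
From HB Require Import structures.
From mathcomp Require Import all_boot all_order all_algebra.
From mathcomp Require Import all_classical all_reals all_analysis.
From mathcomp Require Import ring lra.

Set Implicit Arguments.
Unset Strict Implicit.
Unset Printing Implicit Defensive.

Import Order.TTheory GRing.Theory Num.Theory.
Import numFieldNormedType.Exports.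

Local Open Scope classical_set_scope.
Local Open Scope ring_scope.

(** Write [D] for the Banach space [lip_dual X] of real Lipschitz functions
    vanishing at the origin.  Classically, [D] is the dual of the Lipschitz-free
    space of [X]; the approximation property passes from a dual space to its
    predual, and from the free space one comes back to [X] by the barycenter
    map.  The proof below follows this idea, but works directly with
    increments of Lipschitz maps between pairs of points, which are the
    elementary elements of the free space.

    The maps that approximate the identity have the form
    [y |-> \sum_i h_i y *: v_i] with [h_i] in [D] and [v_i] in [X]
    ([tensor_map]).  By chaining through dyadic nets of a compact set, it is
    enough to approximate the increments [p_i - q_i] of the identity over a
    family of pairs [(p_i, q_i)] up to [e * t_i], where [t_i] tends to [0] and
    [`|p_i - q_i|] is at most [C * t_i ^+ 2] ([lipschitz_approximation]).

    Dividing increments by [t_i], this asks that the bounded family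
    [t_i^-1 *: (p_i - q_i)] be in the closure, for the supremum norm, of the
    subspace of the analogous families of the maps [tensor_map s].  If it is
    not, the Hahn-Banach theorem ([hahn_banach], [separation]) gives a
    contractive functional [F] that kills this subspace and not the family of
    the identity.  All the families considered tend to [0], so [F] acts on
    them through its coordinates [phi_i], which are linear functionals on [X],
    hence elements of [D], with [\sum_i `|phi_i| <= 1]
    ([sum_norm_coordinates]).  That [F] kills the families of the maps
    [h (x) v] means that [\sum_i t_i^-1 * (h p_i - h q_i) *: phi_i = 0] in [D]
    for every [h] in [D], while [F] takes at the family of the identity the
    value [\sum_i t_i^-1 * (phi_i p_i - phi_i q_i)], a kind of trace of the
    same tensor.

    Here the approximation property of [D] enters.  The elements
    [(t_i / `|phi_i|) *: phi_i] tend to [0], so they form a relatively compact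
    set, on which a finite-rank operator [T] is close to the identity.
    Replacing [phi_i] by [T phi_i] changes the trace little.  But the trace
    after replacement is zero: a finite-rank operator on a space of functions
    has the form [T h = \sum_j (T h) y_j *: k_j] ([finite_rank_interpolation]),
    so the trace becomes
    [\sum_j T (\sum_i t_i^-1 * (k_j p_i - k_j q_i) *: phi_i) y_j], and every
    inner sum vanishes.  This contradiction proves [approximate_increments].
    The infinite sums of this sketch are replaced by finite ones with explicit
    error bounds. *)

(** * The Hahn-Banach theorem *)

Section HahnBanach.
Context {R : realType} {V : lmodType R}.
Implicit Types (q r : V -> R) (u v w : V) (t : R).

Definition sublinear q :=
  (forall v w, q (v + w) <= q v + q w) /\
  (forall t v, 0 <= t -> q (t *: v) <= t * q v).

Lemma sublinear0 q : sublinear q -> q 0 = 0.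
Proof.
move=> [qD qZ]; apply/eqP; rewrite eq_le; apply/andP; split.
  by have := qZ 0 0 (lexx 0); rewrite scale0r mul0r.
by have := qD 0 0; rewrite addr0 lerDl.
Qed.

Lemma sublinear_opp q v : sublinear q -> - q (- v) <= q v.
Proof.
move=> ql; by have := ql.1 v (- v); rewrite subrr (sublinear0 ql) -lerBlDr sub0r.
Qed.

Lemma sublinearZ q t v : sublinear q -> 0 <= t -> q (t *: v) = t * q v.
Proof.
move=> ql; rewrite le_eqVlt => /predU1P[<-|t0].
  by rewrite scale0r mul0r sublinear0.
apply/eqP; rewrite eq_le (ql.2 _ _ (ltW t0))/=.
have := ql.2 t^-1 (t *: v); rewrite invr_ge0 (ltW t0) => /(_ isT).
by rewrite scalerK ?gt_eqF// ler_pdivlMl.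
Qed.

(** The largest sublinear functional below [q] whose value at [- u] is at most
    [- q u], which is the value that linearity along [u] demands. *)
Definition straighten q u v : R :=
  inf [set q (v + t *: u) - t * q u | t in [set t | 0 <= t]].

Lemma straighten_lb q u v : sublinear q ->
  lbound [set q (v + t *: u) - t * q u | t in [set t | 0 <= t]] (- q (- v)).
Proof.
move=> ql _ [t t0 <-]; have := ql.1 (v + t *: u) (- v).
by rewrite addrAC subrr add0r sublinearZ//; lra.
Qed.

Lemma straighten_le q u v t : sublinear q -> 0 <= t ->
  straighten q u v <= q (v + t *: u) - t * q u.
Proof.
move=> ql t0; apply: ge_inf; last by exists t.
by exists (- q (- v)); exact: straighten_lb.
Qed.

Lemma straighten_sublinear q u : sublinear q -> sublinear (straighten q u).
Proof.
move=> ql.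
have ne v : [set q (v + t *: u) - t * q u | t in [set t | 0 <= t]] !=set0.
  by exists (q (v + 0 *: u) - 0 * q u), 0 => /=.
split=> [v w|t v].
  rewrite -lerBlDr; apply: lb_le_inf => // _ [s s0 <-].
  rewrite lerBlDr -lerBlDl; apply: lb_le_inf => // _ [t t0 <-].
  rewrite lerBlDl (le_trans (straighten_le _ _ ql (addr_ge0 s0 t0)))//.
  have := ql.1 (v + s *: u) (w + t *: u).
  by rewrite addrACA -scalerDl mulrDl; lra.
rewrite le_eqVlt => /predU1P[<-|t0].
  rewrite scale0r mul0r (le_trans (straighten_le _ _ ql (lexx 0)))//.
  by rewrite scale0r addr0 mul0r subr0 sublinear0.
rewrite -ler_pdivrMl//; apply: lb_le_inf => // _ [s s0 <-].
rewrite ler_pdivrMl// (le_trans (straighten_le _ _ ql (mulr_ge0 (ltW t0) s0)))//.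
by rewrite -scalerA -scalerDr sublinearZ ?(ltW t0)// mulrBr mulrA.
Qed.

(** A chain of sublinear functionals below [q] has its pointwise infimum as a
    lower bound, finite because [- q (- v)] bounds every member below at [v]. *)
Lemma minimal_sublinear q : sublinear q ->
  exists r, [/\ sublinear r, forall v, r v <= q v &
    forall s, sublinear s -> (forall v, s v <= r v) -> forall v, r v <= s v].
Proof.
move=> ql.
pose T := {r : V -> R | sublinear r /\ forall v, r v <= q v}.
pose ge (r s : T) : bool := `[< forall v, sval s v <= sval r v >].
have q0 : T by exists q.
have [|||r rmin] := @ZL_preorder T q0 ge.
- by move=> r; apply/asboolP.
- move=> r s t /asboolP rs /asboolP st; apply/asboolP => v.
  exact: le_trans (st v) (rs v).
- move=> A Atot; have [[r0 Ar0]|/set0P/negP/negPn/eqP ->] := pselect (A !=set0);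
    last by exists q0.
  pose F v := [set sval r v | r in A].
  have lbF v : lbound (F v) (- q (- v)).
    move=> _ [[r [rl rq]] _ <-] /=.
    by rewrite (le_trans _ (sublinear_opp v rl))// lerN2.
  have ne v : F v !=set0 by exists (sval r0 v), r0.
  have leF v (r : T) : A r -> inf (F v) <= sval r v.
    by move=> Ar; apply: ge_inf; [exists (- q (- v))|exists r].
  have il : sublinear (fun v => inf (F v)).
    split=> [v w|t v].
      rewrite -lerBlDr; apply: lb_le_inf => // _ [r Ar <-].
      rewrite lerBlDr -lerBlDl; apply: lb_le_inf => // _ [s As <-].
      rewrite lerBlDl.
      have [/asboolP rs|/asboolP sr] := Atot _ _ Ar As.
        apply: le_trans (leF _ _ As) _; apply: le_trans ((svalP s).1.1 _ _) _.
        by rewrite lerD2r.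
      apply: le_trans (leF _ _ Ar) _; apply: le_trans ((svalP r).1.1 _ _) _.
      by rewrite lerD2l.
    rewrite le_eqVlt => /predU1P[<-|t0].
      rewrite scale0r mul0r (le_trans (leF _ _ Ar0))//.
      by rewrite sublinear0//; exact: (svalP r0).1.
    rewrite -ler_pdivrMl//; apply: lb_le_inf => // _ [r Ar <-].
    rewrite ler_pdivrMl// (le_trans (leF _ _ Ar))//.
    by apply: (svalP r).1.2; exact: ltW.
  have iq v : inf (F v) <= q v by apply: le_trans (leF _ _ Ar0) ((svalP r0).2 v).
  exists (exist _ (fun v => inf (F v)) (conj il iq)) => s As.
  by apply/asboolP => v /=; exact: leF.
case: (svalP r) => rl rq; exists (sval r); split=> // s sl sr.
have sq v : s v <= q v by exact: le_trans (sr v) (rq v).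
have := rmin (exist _ s (conj sl sq)); rewrite /ge /= => h.
by apply/asboolP/h/asboolP.
Qed.

Lemma straighten_sub q u v : sublinear q -> straighten q u v <= q v.
Proof.
move=> ql; rewrite (le_trans (straighten_le _ _ ql (lexx 0)))//.
by rewrite scale0r addr0 mul0r subr0.
Qed.

Lemma straightenN q u : sublinear q -> straighten q u (- u) <= - q u.
Proof.
move=> ql; rewrite (le_trans (straighten_le _ _ ql ler01))//.
by rewrite scale1r addNr sublinear0// mul1r sub0r.
Qed.

(** Straightening a minimal sublinear functional cannot lower it, so it is odd,
    hence linear.  Starting from [straighten q u] instead of [q] forces
    equality with [q] at [u]. *)
Theorem hahn_banach q u : sublinear q ->
  exists F : {scalar V}, (forall v, F v <= q v) /\ F u = q u.
Proof.
move=> ql; have := minimal_sublinear (straighten_sublinear u ql).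
move=> [r [rl rs rmin]].
have rN v : r (- v) = - r v.
  apply/eqP; rewrite eq_le; apply/andP; split; last first.
    by rewrite lerNl sublinear_opp.
  apply: le_trans (straightenN v rl).
  apply: rmin; first exact: straighten_sublinear.
  by move=> w; exact: straighten_sub.
have rD v w : r (v + w) = r v + r w.
  apply/eqP; rewrite eq_le rl.1 /=.
  by have := rl.1 (- v) (- w); rewrite -opprD !rN; lra.
have rlin : scalar r.
  move=> t v w; rewrite rD; congr (_ + _).
  have [t0|t0] := leP 0 t; first exact: sublinearZ.
  have t1 : 0 <= - t by rewrite oppr_ge0 ltW.
  by rewrite -[t]opprK scaleNr rN (sublinearZ _ rl t1) /= !mulNr.
have Flin := GRing.isLinear.Build R V R *%R r rlin.
pose F : {scalar V} := HB.pack r Flin.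
have rq v : r v <= q v by apply: le_trans (rs v) (straighten_sub u v ql).
exists F; split=> //=; apply/eqP; rewrite eq_le rq /=.
by rewrite -lerN2 -rN (le_trans (rs _))// straightenN.
Qed.

End HahnBanach.

(** * Compact sets and uniform convergence on them *)

Section UniformConvergenceOnCompacts.
Context {R : realType}.

(** Compact sets are closed under finite unions, so the tubes around [f] over
    compact sets form a filter base and one tube suffices to test closure. *)
Lemma tau_c_closureP (U V : normedModType R) (A : set (U -> V)) (f : U -> V) :
  tau_c_closure A f <->
  (forall (K : set U) (e : R), compact K -> 0 < e ->
    exists2 g, A g & forall x, K x -> `|f x - g x| < e).
Proof.
split=> [Af K e cK e0|Af].
  have entE : entourage [set xy : V * V | ball xy.1 e xy.2].
    exact: entourage_ball (PosNum e0).
  have [g [Ag fg]] := Af _ (fam_nbhs (f : {family compact, U -> V}) entE cK).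
  exists g => // x /fg; by rewrite /= -ball_normE.
rewrite /tau_c_closure closureEcvg.
pose B (Ke : set U * R) :=
  [set g | A g /\ forall x, Ke.1 x -> `|f x - g x| < Ke.2].
pose D := [set Ke : set U * R | compact Ke.1 /\ 0 < Ke.2].
have FF : ProperFilter (filter_from D B).
  apply: filter_from_proper; last first.
    by move=> [K e] [cK e0]; have [g Ag fg] := Af K e cK e0; exists g.
  apply: filter_from_filter; first by exists (set0, 1); split=> //; exact: compact0.
  move=> [K e] [L d] [/= cK e0] [/= cL d0].
  exists (K `|` L, Num.min e d).
    by split; [exact: compactU|rewrite lt_min e0].
  move=> g [Ag /= fg]; split; split=> //= x Kx.
    by have := fg x (or_introl Kx); rewrite lt_min => /andP[].
  by have := fg x (or_intror Kx); rewrite lt_min => /andP[].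
exists (filter_from D B) => //; split=> [|C AC].
  apply/fam_cvgP => K cK P /uniform_nbhs[E [entE EP]].
  move: entE; rewrite -entourage_ballE => -[e /= e0 eE].
  exists (K, e) => //= g [_ fg]; apply: EP => x /fg fgx.
  by apply: eE; rewrite /= -ball_normE.
by exists (set0, 1); [split=> //; exact: compact0|move=> g [/AC]].
Qed.

(** A filter that stays away from [0] is carried by finitely many of the
    [u i]. *)
Lemma compact_null_family (E : normedModType R) (I : choiceType) (u : I -> E) :
  (forall e : R, 0 < e -> exists r : seq I, forall i, i \notin r -> `|u i| < e) ->
  compact (0 |` range u).
Proof.
move=> unull F PF Fu; have [F0|/existsNP[B /existsNP[C]]] :=
    pselect (cluster F 0); first by exists 0; split=> //; left.
move=> /not_implyP[FB /not_implyP[/nbhs_ballP[e /= e0 eC] BC]].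
have [r ur] := unull e e0.
have cr : compact (u @` [set` r]).
  by apply: finite_compact; exact/finite_image/finite_seq.
have [|x [[i _ <-] Fx]] := cr F PF; last first.
  by exists (u i); split=> //; right; exists i.
apply: filterS (filterI FB Fu) => x [Bx ux].
have xC : ~ C x by move=> Cx; apply: BC; exists x.
have xe : ~ `|x| < e.
  by move=> xe; apply/xC/eC; rewrite -ball_normE /= sub0r normrN.
case: ux => [x0|[i _ iux]]; first by case: xe; rewrite x0 normr0.
exists i => //=; apply/negPn/negP => /ur; by rewrite iux.
Qed.

Lemma compact_net (E : normedModType R) (K : set E) (e : R) :
  compact K -> 0 < e ->
  exists s : seq E, forall x, K x -> exists2 y, y \in s & `|x - y| < e.
Proof.
rewrite compact_cover => cK e0.
have [|x Kx|s _ sK] := cK E setT (fun y => ball y e).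
- by move=> y _; exact: ball_open.
- by exists x => //; exact: ballxx.
exists (finmap.enum_fset s) => x /sK[y /= sy]; rewrite -ball_normE /= => xy.
by exists y => //; rewrite distrC.
Qed.

End UniformConvergenceOnCompacts.

(** * Finite-rank operators and maps *)

Section FiniteRank.
Context {R : realType} {X : normedModType R}.
Local Notation D := (lip_dual X).

Lemma lip_dual_sum (I : Type) (r : seq I) (F : I -> D) (x : X) :
  (\sum_(i <- r) F i) x = \sum_(i <- r) F i x.
Proof. exact: (big_morph (fun h : D => h x)). Qed.

(** The points are chosen one function at a time: if the operator interpolating
    at the points chosen so far misses [g], then the error [g - P g] is nonzero
    at some [x], and correcting along this error by the value at [x] repairs
    [g] without disturbing the functions already reproduced. *)
Lemma interpolation (s : seq D) : exists r : seq (X * D),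
  forall h : D, h \in s -> h = \sum_(yk <- r) h yk.1 *: yk.2.
Proof.
elim: s => [|g s [r rP]]; first by exists [::].
pose P (w : D) : D := \sum_(yk <- r) w yk.1 *: yk.2.
have [gP|/eqP gP] := pselect (g = P g).
  by exists r => h; rewrite inE => /predU1P[->//|/rP].
have [x gx] : exists x, (g - P g) x != 0.
  apply: contrapT => /forallNP g0; case/eqP: gP.
  apply/eqP; rewrite -subr_eq0; apply/eqP/val_inj/funext => x.
  by apply/eqP/negPn/negP/g0.
pose k0 : D := ((g - P g) x)^-1 *: (g - P g).
have corrected (h : D) :
    h x *: k0 + \sum_(yk <- r) h yk.1 *: (yk.2 - (yk.2 : D) x *: k0) =
    P h + (h x - P h x) *: k0.
  under eq_bigr do rewrite scalerBr scalerA.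
  rewrite big_split/= sumrN -scaler_suml scalerBl lip_dual_sum.
  by rewrite addrCA.
exists ((x, k0) :: [seq (yk.1, yk.2 - (yk.2 : D) x *: k0) | yk <- r]) => h hgs.
rewrite big_cons big_map /= corrected; move: hgs.
rewrite inE => /predU1P[->|/rP hP].
  by rewrite scalerA divff// scale1r addrC subrK.
by rewrite /P -hP subrr scale0r addr0.
Qed.

(** Point evaluations serve as bounded coordinates on the range of [T], so no
    comparison of norms on finite-dimensional spaces is needed. *)
Lemma finite_rank_interpolation (T : D -> D) : bounded_finite_rank D T ->
  exists r : seq (X * D), forall h, T h = \sum_(yk <- r) T h yk.1 *: yk.2.
Proof.
move=> [L [-> _ [n [b Lb]]]].
have [r rP] := interpolation (codom b); exists r => h.
have [m [a [z [zb ->]]]] : lin_span (range b) (L h) by rewrite -Lb; exists h.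
have {1}-> : \sum_(i < m) a i *: z i =
    \sum_(i < m) a i *: \sum_(yk <- r) z i yk.1 *: yk.2.
  by apply: eq_bigr => i _; rewrite -rP//; have [j _ <-] := zb i; exact: codom_f.
under eq_bigr do rewrite scaler_sumr.
rewrite exchange_big; apply: eq_bigr => yk _.
by rewrite lip_dual_sum scaler_suml; apply: eq_bigr => i _; rewrite scalerA.
Qed.

Context {Y : normedModType R}.
Implicit Types s : seq (D * Y).

(** The map represented by the element [\sum h (x) v] of the algebraic tensor
    product of the Lipschitz dual of [X] with [Y]. *)
Definition tensor_map s (y : X) : Y := \sum_(hv <- s) hv.1 y *: hv.2.

Lemma tensor_map_cat s1 s2 y :
  tensor_map (s1 ++ s2) y = tensor_map s1 y + tensor_map s2 y.
Proof. exact: big_cat. Qed.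

Lemma tensor_map_scale (t : R) s y :
  tensor_map [seq (hv.1, t *: hv.2) | hv <- s] y = t *: tensor_map s y.
Proof.
rewrite /tensor_map big_map scaler_sumr; apply: eq_bigr => hv _ /=.
by rewrite !scalerA mulrC.
Qed.

Definition tensor_lip s : R := \sum_(hv <- s) `|hv.1| * `|hv.2|.

Lemma tensor_map_lip s x y :
  `|tensor_map s x - tensor_map s y| <= tensor_lip s * `|x - y|.
Proof.
rewrite /tensor_map -sumrB mulr_suml; apply: le_trans (ler_norm_sum _ _ _) _.
apply: ler_sum => hv _; rewrite -scalerBl normrZ mulrAC ler_wpM2r//.
exact: lip_dual_normP.
Qed.

Lemma tensor_map0 s : tensor_map s 0 = 0.
Proof. by apply: big1 => hv _; rewrite lip_dual_0 scale0r. Qed.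

(** Interpolating the first components expresses every value of the map through
    its values at finitely many points, which therefore span the range. *)
Lemma tensor_map_Lip0F s : Lip0F X Y (tensor_map s).
Proof.
split.
  by apply: Lip0_intro (tensor_map0 s) _; exact: tensor_map_lip.
have [r rP] := interpolation [seq hv.1 | hv <- s].
have fr c : tensor_map s c = \sum_(yk <- r) yk.2 c *: tensor_map s yk.1.
  under [RHS]eq_bigr do rewrite scaler_sumr.
  rewrite exchange_big/=; apply: eq_big_seq => hv hvs.
  rewrite (rP hv.1) ?map_f// lip_dual_sum scaler_suml; apply: eq_bigr => yk _.
  by rewrite lip_dualZ scalerA mulrC -rP// map_f.
exists (size r), (fun j => tensor_map s (tnth (in_tuple r) j).1).
apply/seteqP; split=> v [m [a [z [zf ->]]]].
  have /choice[c cP] : forall i, exists c, tensor_map s c = z i.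
    by move=> i; have [c _ <-] := zf i; exists c.
  exists (size r), (fun j => \sum_(i < m) a i * (tnth (in_tuple r) j).2 (c i)).
  exists (fun j => tensor_map s (tnth (in_tuple r) j).1).
  split; first by move=> i; exists i.
  under eq_bigr do rewrite -cP fr scaler_sumr.
  rewrite exchange_big/= big_tnth; apply: eq_bigr => j _.
  by rewrite scaler_suml; apply: eq_bigr => i _; rewrite scalerA.
exists m, a, z; split=> // i.
by have [j _ <-] := zf i; exists (tnth (in_tuple r) j).1.
Qed.

End FiniteRank.

(** * Bounded families and functionals on them *)

Definition bounded_pred (R : realType) (I : choiceType) (X : normedModType R) :
    {pred I -> X} :=
  mem [set v : I -> X | exists M : R, forall i, `|v i| <= M].
Arguments bounded_pred {R} I X.

Record bounded_map (R : realType) (I : choiceType) (X : normedModType R) :=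
  BoundedMap {
    bounded_map_fun :> I -> X;
    bounded_map_subproof : bounded_map_fun \in bounded_pred I X
  }.

HB.instance Definition _ (R : realType) (I : choiceType) (X : normedModType R) :=
  [isSub of bounded_map I X for @bounded_map_fun R I X].
HB.instance Definition _ (R : realType) (I : choiceType) (X : normedModType R) :=
  [Choice of bounded_map I X by <:].

Section BoundedMaps.
Context {R : realType} {I : choiceType} {X : normedModType R}.
Local Notation B := (bounded_map I X).

Lemma bounded_submod_closed : submod_closed (bounded_pred I X).
Proof.
split; first by apply/mem_set; exists 0 => i; rewrite normr0.
move=> a u v /set_mem[M uM] /set_mem[N vN]; apply/mem_set.
exists (`|a| * M + N) => i; apply: le_trans (ler_normD _ _) _.
by rewrite normrZ lerD// ler_wpM2l.
Qed.

HB.instance Definition _ := GRing.isSubmodClosed.Build R (I -> X)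
  (bounded_pred I X) bounded_submod_closed.
HB.instance Definition _ := [SubChoice_isSubLmodule of B by <:].

Lemma bounded_mapD (u v : B) i : (u + v) i = u i + v i. Proof. by []. Qed.
Lemma bounded_mapB (u v : B) i : (u - v) i = u i - v i. Proof. by []. Qed.
Lemma bounded_mapN (v : B) i : (- v) i = - v i. Proof. by []. Qed.
Lemma bounded_mapZ (a : R) (v : B) i : (a *: v) i = a *: v i. Proof. by []. Qed.
Lemma bounded_map_sum (J : Type) (r : seq J) (F : J -> B) i :
  (\sum_(j <- r) F j) i = \sum_(j <- r) F j i.
Proof. exact: (big_morph (fun v : B => v i)). Qed.

Lemma bounded_mapP (v : B) : exists2 M : R, 0 <= M & forall i, `|v i| <= M.
Proof.
have [M vM] := set_mem (bounded_map_subproof v); exists `|M| => // i.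
exact: le_trans (vM i) (ler_norm M).
Qed.

(** Total, with value [0] at unbounded maps, so that a family can be named
    before a bound for it is proved. *)
Definition to_bounded (v : I -> X) : B := insubd 0 v.

Lemma to_boundedE (v : I -> X) (M : R) :
  (forall i, `|v i| <= M) -> to_bounded v = v :> (I -> X).
Proof. by move=> vM; rewrite /to_bounded val_insubd mem_set//; exists M. Qed.

Definition single (i : I) (x : X) : B :=
  to_bounded (fun j => if j == i then x else 0).

Lemma singleE i x j : single i x j = if j == i then x else 0.
Proof.
rewrite /single (@to_boundedE _ `|x|)// => {}j.
by case: ifP; rewrite ?normr0.
Qed.

Lemma singleD i x y : single i (x + y) = single i x + single i y.
Proof.
apply/val_inj/funext => j; rewrite /= [RHS]bounded_mapD !singleE.
by case: ifP; rewrite ?addr0.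
Qed.

Lemma singleZ i (a : R) x : single i (a *: x) = a *: single i x.
Proof.
apply/val_inj/funext => j; rewrite /= [RHS]bounded_mapZ !singleE.
by case: ifP; rewrite ?scaler0.
Qed.

Lemma sum_singleE (r : seq I) (x : I -> X) j : uniq r ->
  (\sum_(i <- r) single i (x i)) j = if j \in r then x j else 0.
Proof.
move=> ur; rewrite bounded_map_sum.
under eq_bigr do rewrite singleE.
case: ifPn => jr.
  rewrite (bigD1_seq j)//= eqxx big1 ?addr0// => i ij.
  by rewrite eq_sym (negbTE ij).
rewrite big_seq big1// => i ir; case: eqP => // ji.
by rewrite ji ir in jr.
Qed.

(** The distance to [S] for the supremum norm is sublinear; a linear functional
    below it that agrees with it at [v0] is contractive, kills [S] and does not
    kill [v0]. *)
Lemma separation (S : set B) (v0 : B) (e : R) :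
  S 0 -> (forall u v, S u -> S v -> S (u + v)) ->
  (forall a v, S v -> S (a *: v)) ->
  (forall s, S s -> ~ forall i, `|v0 i - s i| <= e) ->
  exists F : {scalar B},
    [/\ forall (v : B) (M : R), 0 <= M -> (forall i, `|v i| <= M) -> `|F v| <= M,
        forall s, S s -> F s = 0 & e <= F v0].
Proof.
move=> S0 SD SZ Sv0.
pose A (v : B) :=
  [set M : R | 0 <= M /\ exists2 s, S s & forall i, `|v i - s i| <= M].
pose q v := inf (A v).
have A0 v : lbound (A v) 0 by move=> M [].
have ne v : A v !=set0.
  have [M M0 vM] := bounded_mapP v; exists M; split=> //; exists 0 => // i.
  by rewrite subr0.
have q_le v M : A v M -> q v <= M by move=> AM; apply: ge_inf => //; exists 0.
have ql : sublinear q.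
  split=> [u v|a v].
    rewrite -lerBlDr; apply: lb_le_inf => // M [M0 [s Ss uM]].
    rewrite lerBlDr -lerBlDl; apply: lb_le_inf => // N [N0 [s' Ss' vN]].
    rewrite lerBlDl; apply: q_le; split; first exact: addr_ge0.
    exists (s + s') => [|i]; first exact: SD.
    by rewrite !bounded_mapD opprD addrACA (le_trans (ler_normD _ _))// lerD.
  rewrite le_eqVlt => /predU1P[<-|a0].
    rewrite scale0r mul0r; apply: q_le; split=> //; exists 0 => // i.
    by rewrite subrr normr0.
  rewrite -ler_pdivrMl//; apply: lb_le_inf => // M [M0 [s Ss vM]].
  rewrite ler_pdivrMl//; apply: q_le; split; first by rewrite mulr_ge0// ltW.
  exists (a *: s) => [|i]; first exact: SZ.
  by rewrite !bounded_mapZ -scalerBr normrZ gtr0_norm// ler_pM2l.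
have [F [Fq Fv0]] := hahn_banach v0 ql; exists F.
have F_le (v : B) M s :
    0 <= M -> S s -> (forall i, `|v i - s i| <= M) -> `|F v| <= M.
  move=> M0 Ss vM; rewrite ler_norml lerNl -linearN; apply/andP; split.
    apply: le_trans (Fq _) _; apply: q_le; split=> //.
    exists (- s) => [|i]; first by rewrite -scaleN1r; exact: SZ.
    by rewrite !bounded_mapN -opprD normrN.
  by apply: le_trans (Fq _) _; apply: q_le; split=> //; exists s.
split.
- by move=> v M M0 vM; apply: (F_le v M 0) => // i; rewrite subr0.
- move=> s Ss; apply/eqP; rewrite -normr_le0; apply: (F_le s 0 s) => // i.
  by rewrite subrr normr0.
- rewrite Fv0; apply: lb_le_inf => // M [_ [s Ss vM]].
  rewrite leNgt; apply/negP => Me; apply: (Sv0 s Ss) => i.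
  exact: le_trans (vM i) (ltW Me).
Qed.

Section Coordinates.
Variable F : {scalar B}.
Hypothesis F_le : forall (v : B) (M : R),
  0 <= M -> (forall i, `|v i| <= M) -> `|F v| <= M.

(** The functionals on bounded families are not determined by their
    coordinates, but this estimate determines them on families tending to
    [0]. *)
Lemma truncation (r : seq I) (v : B) (M : R) : uniq r -> 0 <= M ->
  (forall i, i \notin r -> `|v i| <= M) ->
  `|F v - \sum_(i <- r) F (single i (v i))| <= M.
Proof.
move=> ur M0 vM; rewrite -linear_sum -linearB; apply: F_le => // j.
rewrite bounded_mapB sum_singleE//; case: ifPn => jr.
  by rewrite subrr normr0.
by rewrite subr0 vM.
Qed.

Lemma coordinate_exists i :
  exists phi : lip_dual X, forall x, phi x = F (single i x).
Proof.
have phiL : Lip0 X R^o (fun x => F (single i x)).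
  apply: (@Lip0_intro _ _ _ _ 1) => [|x y].
    by rewrite -[0 in LHS](scale0r 0) singleZ scale0r linear0.
  rewrite -linearB mul1r; apply: F_le => // j.
  rewrite -scaleN1r -singleZ scaleN1r -singleD singleE.
  by case: ifP; rewrite ?normr0.
by exists (LipDual (mem_set phiL)).
Qed.

Lemma norming_vector (phi : lip_dual X) (e : R) :
  (forall x y, phi (x - y) = phi x - phi y) ->
  (forall a x, phi (a *: x) = a * phi x) ->
  0 < e -> exists2 x, `|x| <= 1 & `|phi| - e <= phi x.
Proof.
move=> phiB phiZ e0; apply: contrapT => /forall2NP nex.
have lt x : `|x| <= 1 -> phi x < `|phi| - e.
  by move=> x1; have [//|/negP] := nex x; rewrite -ltNge.
have k0 : 0 < `|phi| - e.
  by have := lt 0; rewrite normr0 lip_dual_0; apply.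
have le z : phi z <= (`|phi| - e) * `|z|.
  have [->|z0] := eqVneq z 0; first by rewrite lip_dual_0 normr0 mulr0.
  have nz : 0 < `|z| by rewrite normr_gt0.
  have z1 : `| `|z|^-1 *: z | <= 1.
    by rewrite normrZ normfV normr_id mulVf// gt_eqF.
  by have := ltW (lt _ z1); rewrite phiZ ler_pdivrMl// mulrC.
suff phi_le : `|phi| <= `|phi| - e by move: phi_le; lra.
apply: lip_const_le => [|x y]; first exact: ltW.
rewrite -phiB ler_norml le andbT lerNl -[in leRHS]normrN.
by rewrite -mulN1r -phiZ scaleN1r le.
Qed.

Variable phi : I -> lip_dual X.
Hypothesis phiE : forall i x, phi i x = F (single i x).

Lemma coordinateB i x y : phi i (x - y) = phi i x - phi i y.
Proof. by rewrite !phiE -scaleN1r singleD singleZ linearD linearZ/= mulN1r. Qed.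

Lemma coordinateZ i (a : R) x : phi i (a *: x) = a * phi i x.
Proof. by rewrite !phiE singleZ linearZ/=. Qed.

(** Nearly norming vectors, one for each index of [r], assemble into a single
    element of the unit ball. *)
Lemma sum_norm_coordinates (r : seq I) : uniq r -> \sum_(i <- r) `|phi i| <= 1.
Proof.
move=> ur; apply/ler_addgt0Pr => e e0.
have d0 : 0 < e / (size r).+1%:R by rewrite divr_gt0.
have /choice[x xP] : forall i, exists x, `|x| <= 1 /\
    `|phi i| - e / (size r).+1%:R <= phi i x.
  move=> i; have [x x1 xe] :=
    norming_vector (coordinateB i) (coordinateZ i) d0; by exists x.
have : `|F (\sum_(i <- r) single i (x i))| <= 1.
  apply: F_le => // j; rewrite sum_singleE//.
  by case: ifP; rewrite ?normr0//; have [] := xP j.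
move=> /(le_trans (ler_norm _)); rewrite linear_sum => F1.
have : \sum_(i <- r) (`|phi i| - e / (size r).+1%:R) <= 1.
  by apply: le_trans F1; apply: ler_sum => i _; rewrite -phiE; have [] := xP i.
rewrite sumrB big_const_seq count_predT iter_addr_0 lerBlDr.
move=> /le_trans; apply; rewrite lerD2l -[leLHS]mulr_natl mulrCA ger_pMr//.
by rewrite ler_pdivrMr// mul1r ler_nat.
Qed.

End Coordinates.
End BoundedMaps.

(** * Approximation of increments *)

Section Increments.
Context {R : realType} {X : normedModType R} {I : choiceType}.
Variables (t : I -> R) (p q : I -> X) (C : R).
Hypothesis t_gt0 : forall i, 0 < t i.
Hypothesis t_le1 : forall i, t i <= 1.
Hypothesis t_null : forall e : R, 0 < e ->
  exists r : seq I, forall i, i \notin r -> t i < e.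
Hypothesis C_ge0 : 0 <= C.
Hypothesis pq_le : forall i, `|p i - q i| <= C * t i ^+ 2.
Local Notation D := (lip_dual X).
Local Notation B := (bounded_map I X).

Definition increment {Y : normedModType R} (f : X -> Y) (i : I) : Y :=
  (t i)^-1 *: (f (p i) - f (q i)).

(** One factor [t i] of the bound on [`|p i - q i|] pays for the division; the
    other one makes the increments of a Lipschitz map tend to [0]. *)
Lemma increment_le {Y : normedModType R} (f : X -> Y) (L : R) i :
  0 <= L -> (forall x y, `|f x - f y| <= L * `|x - y|) ->
  `|increment f i| <= L * C * t i.
Proof.
move=> L0 fL; rewrite normrZ gtr0_norm ?invr_gt0// ler_pdivrMl//.
apply: le_trans (fL _ _) _.
have -> : t i * (L * C * t i) = L * (C * t i ^+ 2) by ring.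
by rewrite ler_wpM2l.
Qed.

Lemma increment_bounded {Y : normedModType R} (f : X -> Y) (L : R) i :
  0 <= L -> (forall x y, `|f x - f y| <= L * `|x - y|) ->
  `|increment f i| <= L * C.
Proof.
move=> L0 fL; apply: le_trans (increment_le i L0 fL) _.
by rewrite ler_piMr// mulr_ge0.
Qed.

Lemma tensor_lip_ge0 (s : seq (D * X)) : 0 <= tensor_lip s.
Proof. by apply: sumr_ge0 => hv _; rewrite mulr_ge0. Qed.

Definition tensor_increments : set B :=
  [set v | exists s : seq (D * X), forall i, v i = increment (tensor_map s) i].

Lemma tensor_increments_ex (s : seq (D * X)) : exists2 v : B,
  tensor_increments v & forall i, v i = increment (tensor_map s) i.
Proof.
exists (to_bounded (increment (tensor_map s))); [exists s => i|move=> i];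
  by rewrite (to_boundedE (fun i => increment_bounded i (tensor_lip_ge0 s)
    (tensor_map_lip s))).
Qed.

Lemma tensor_increments0 : tensor_increments 0.
Proof.
by exists [::] => i; rewrite /increment /tensor_map !big_nil subrr scaler0.
Qed.

Lemma tensor_incrementsD u v :
  tensor_increments u -> tensor_increments v -> tensor_increments (u + v).
Proof.
move=> [s us] [s' vs]; exists (s ++ s') => i.
rewrite bounded_mapD us vs /increment !tensor_map_cat -scalerDr.
by rewrite opprD addrACA.
Qed.

Lemma tensor_incrementsZ a v :
  tensor_increments v -> tensor_increments (a *: v).
Proof.
move=> [s vs]; exists [seq (hv.1, a *: hv.2) | hv <- s] => i.
rewrite bounded_mapZ vs /increment !tensor_map_scale -scalerBr.
by rewrite !scalerA mulrC.
Qed.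

Lemma increment_id_bounded (i : I) : `|increment (@id X) i| <= 1 * C.
Proof. by apply: increment_bounded => // x y; rewrite mul1r. Qed.

Section Annihilator.
Variables (F : {scalar B}) (phi : I -> D).
Hypothesis F_le : forall (v : B) (M : R),
  0 <= M -> (forall i, `|v i| <= M) -> `|F v| <= M.
Hypothesis F_tensor : forall v, tensor_increments v -> F v = 0.
Hypothesis phiE : forall i x, phi i x = F (single i x).

(** Up to the truncation error, [z |-> \sum_i increment k i * phi i z] is
    [z |-> F (increments of k (x) z)], which vanishes. *)
Lemma annihilated_le (r : seq I) (k : D) (d : R) : uniq r -> 0 <= d ->
  (forall i, i \notin r -> t i <= d) ->
  `|\sum_(i <- r) increment k i *: phi i| <= `|k| * C * d.
Proof.
move=> ur d0 rd; apply: lip_const_le => [|x y]; first by rewrite !mulr_ge0.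
have [v vs vE] := tensor_increments_ex [:: (k, x - y)].
have {}vE i : v i = increment k i *: (x - y).
  by rewrite vE /increment /tensor_map !big_seq1 /= -scalerBl scalerA.
rewrite !lip_dual_sum -sumrB.
have -> : \sum_(i <- r) ((increment k i *: phi i) x - (increment k i *: phi i) y)
    = \sum_(i <- r) F (single i (v i)).
  apply: eq_bigr => i _; rewrite vE !lip_dualZ -mulrBr.
  by rewrite -(coordinateB phiE) singleZ linearZ/= phiE.
have := truncation F_le (v := v) (M := `|k| * C * d * `|x - y|) ur.
rewrite F_tensor// sub0r normrN; apply; first by rewrite !mulr_ge0.
move=> i ir; rewrite vE normrZ ler_wpM2r//.
apply: le_trans (increment_le i (normr_ge0 k) (lip_dual_normP k)) _.
by rewrite ler_wpM2l ?mulr_ge0// rd.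
Qed.

(** The sum is the trace of the composite of [T] with a tensor that represents
    [0]; as the coordinates of [T] are evaluations at points, it is a finite
    combination of values of [T] at sums that [annihilated_le] bounds. *)
Lemma annihilated_finite_rank_le (T : {linear D -> D}) (M d : R)
    (s : seq (X * D)) (r : seq I) :
  (forall h, `|T h| <= M * `|h|) ->
  (forall h, T h = \sum_(yk <- s) T h yk.1 *: yk.2) ->
  uniq r -> 0 <= d -> (forall i, i \notin r -> t i <= d) ->
  `|\sum_(i <- r) increment (T (phi i)) i| <=
    (\sum_(yk <- s) `|M| * `|yk.2| * C * `|yk.1|) * d.
Proof.
move=> TM Ts ur d0 rd.
have -> : \sum_(i <- r) increment (T (phi i)) i =
    \sum_(yk <- s) T (\sum_(i <- r) increment yk.2 i *: phi i) yk.1.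
  have TZ (a : R) h y : T (a *: h) y = a * T h y by rewrite linearZ_LR.
  under [RHS]eq_bigr do rewrite linear_sum lip_dual_sum.
  rewrite exchange_big/=; apply: eq_bigr => i _.
  rewrite /increment [in LHS]Ts !lip_dual_sum -sumrB scaler_sumr.
  apply: eq_bigr => yk _; rewrite !lip_dualZ TZ.
  by rewrite /GRing.scale/=; ring.
rewrite mulr_suml; apply: le_trans (ler_norm_sum _ _ _) _.
apply: ler_sum => yk _.
set g := (X in T X); have gd : `|g| <= `|yk.2| * C * d by exact: annihilated_le.
have := lip_dual_normP (T g) yk.1 0; rewrite lip_dual_0 !subr0 => /le_trans; apply.
rewrite mulrAC ler_wpM2r//; apply: le_trans (TM g) _.
apply: (@le_trans _ _ (`|M| * `|g|)); first by rewrite ler_wpM2r// ler_norm.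
by rewrite -!mulrA ler_wpM2l// mulrA.
Qed.

(** The hypothesis on [T] is its closeness to the identity on the normalized
    coordinates [(t i / `|phi i|) *: phi i]; the factor [(t i)^-1] it loses is
    recovered from the increments. *)
Lemma sum_increments_le (T : D -> D) (eta : R) (r : seq I) :
  uniq r -> 0 <= eta ->
  (forall i, `|phi i - T (phi i)| <= eta * ((t i)^-1 * `|phi i|)) ->
  `|\sum_(i <- r) increment (phi i - T (phi i)) i| <= C * eta.
Proof.
move=> ur eta0 Teta; apply: le_trans (ler_norm_sum _ _ _) _.
have C1 : C * eta * (\sum_(i <- r) `|phi i|) <= C * eta.
  by rewrite ler_piMr ?mulr_ge0// (sum_norm_coordinates F_le phiE).
apply: le_trans C1; rewrite mulr_sumr; apply: ler_sum => i _.
apply: le_trans (increment_le i (normr_ge0 _) (lip_dual_normP _)) _.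
apply: (@le_trans _ _ (eta * ((t i)^-1 * `|phi i|) * C * t i)).
  by rewrite !ler_wpM2r// ltW.
have ti0 : t i != 0 by rewrite gt_eqF.
by rewrite le_eqVlt; apply/orP; left; apply/eqP; field.
Qed.

End Annihilator.

Lemma normalized_coordinates_compact (phi : I -> D) :
  compact (0 |` range (fun i => (t i * `|phi i|^-1) *: phi i)).
Proof.
apply: compact_null_family => e e0; have [r rt] := t_null e0.
exists r => i /rt; apply: le_lt_trans.
rewrite normrZ normrM normfV normr_id gtr0_norm//.
have [->|phi0] := eqVneq `|phi i| 0; first by rewrite mulr0 ltW.
by rewrite mulfVK.
Qed.

(** Both sides of the contradiction are estimates of [F] at the increments of
    the identity: it is at least [e] by separation, and at most [3 / 4 * e]
    once the coordinates are replaced by their images under a finite-rank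
    operator. *)
Theorem approximate_increments : approximation_property D ->
  forall e : R, 0 < e -> exists s : seq (D * X), forall i,
  `|(p i - q i) - (tensor_map s (p i) - tensor_map s (q i))| <= e * t i.
Proof.
move=> /tau_c_closureP AP e e0; apply: contrapT => /forallNP noS.
pose v0 : B := to_bounded (increment id).
have v0E i : v0 i = increment id i.
  by rewrite (to_boundedE increment_id_bounded).
have [|F [F_le F_tensor F0]] := separation (v0 := v0) (e := e)
    tensor_increments0 tensor_incrementsD tensor_incrementsZ.
  move=> v [s vs] v0v; apply: (noS s) => i; have := v0v i.
  rewrite v0E vs /increment -scalerBr normrZ gtr0_norm ?invr_gt0//.
  by rewrite ler_pdivrMl// mulrC.
have /choice[phi phiE] := coordinate_exists F_le.
have ratio_le (a b : R) : 0 <= a -> 0 < b -> a * (e / (b * (a + 1))) <= e / b.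
  move=> a0 b0; have a1 : 0 < a + 1 by rewrite ltr_wpDl.
  rewrite mulrA ler_pdivrMr ?mulr_gt0//.
  have -> : e / b * (b * (a + 1)) = a * e + e by field; rewrite gt_eqF.
  by rewrite lerDl ltW.
(* The replacement costs [C * eta]; the added [1] allows [C = 0]. *)
pose eta := e / (4 * (C + 1)).
have eta0 : 0 < eta by rewrite divr_gt0// mulr_gt0// ltr_wpDl.
have [T Tfr Teta] := AP _ _ (@normalized_coordinates_compact phi) eta0.
have [s Ts] := finite_rank_interpolation Tfr.
move: Tfr => [L [TL [M LM] _]]; rewrite {}TL in Teta Ts.
have Lphi i : `|phi i - L (phi i)| <= eta * ((t i)^-1 * `|phi i|).
  have [phi0|phi0] := eqVneq `|phi i| 0.
    by rewrite (normr0_eq0 phi0) linear0 subrr normr0 !mulr0.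
  have n0 : 0 < `|phi i| by rewrite lt_neqAle eq_sym phi0 normr_ge0.
  have : `|(t i * `|phi i|^-1) *: phi i - L ((t i * `|phi i|^-1) *: phi i)| < eta.
    by apply: Teta; right; exists i.
  rewrite linearZ_LR -scalerBr normrZ normrM normfV normr_id gtr0_norm// => /ltW.
  rewrite mulrC -ler_pdivlMr ?mulr_gt0 ?invr_gt0//.
  by rewrite invfM invrK.
pose S := \sum_(yk <- s) `|M| * `|yk.2| * C * `|yk.1|.
have S0 : 0 <= S by apply: sumr_ge0 => yk _; rewrite !mulr_ge0.
(* Truncation costs [C * d] for the identity and [S * d] after replacement;
   [S] depends on the operator, so [d] is chosen after it. *)
pose d := e / (2 * (C + S + 1)).
have d0 : 0 < d by rewrite divr_gt0// mulr_gt0// ltr_wpDl// addr_ge0.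
have [r' r't] := t_null d0; pose r := undup r'.
have rt i : i \notin r -> t i <= d by rewrite mem_undup => /r't/ltW.
have ur : uniq r := undup_uniq r'.
have trunc : `|F v0 - \sum_(i <- r) increment (phi i) i| <= C * d.
  have -> : \sum_(i <- r) increment (phi i) i =
      \sum_(i <- r) F (single i (v0 i)).
    apply: eq_bigr => i _; rewrite -phiE v0E /increment.
    by rewrite (coordinateZ phiE) (coordinateB phiE).
  apply: truncation => //; first by rewrite mulr_ge0// ltW.
  move=> i /rt ti; rewrite v0E -[C]mul1r.
  apply: le_trans (increment_le (L := 1) i _ _) _ => //.
    by move=> x y; rewrite mul1r.
  by rewrite !mul1r ler_wpM2l.
have small := sum_increments_le F_le phiE ur (ltW eta0) Lphi.
have finite := annihilated_finite_rank_le F_le F_tensor phiE LM Ts ur (ltW d0) rt.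
have split_sum : \sum_(i <- r) increment (phi i) i =
    \sum_(i <- r) increment (phi i - L (phi i)) i +
    \sum_(i <- r) increment (L (phi i)) i.
  rewrite -big_split; apply: eq_bigr => i _.
  by rewrite /increment !lip_dualB /GRing.scale/=; ring.
have Ceta : C * eta <= e / 4 by exact: ratio_le.
have CSd : (C + S) * d <= e / 2 by apply: ratio_le => //; exact: addr_ge0.
move: trunc small finite; rewrite split_sum -/S !ler_norml.
move: F0 CSd Ceta; rewrite mulrDl; lra.
Qed.

End Increments.

(** * Chaining *)

Section Chaining.
Context {R : realType} {X : normedModType R}.
Local Notation half := (2^-1 : R).

Lemma half_pow_lt (e : R) : 0 < e ->
  exists N, forall k, (N <= k)%N -> half ^+ k < e.
Proof.
move=> e0; have h1 : `|half| < 1 by rewrite ger0_norm ?invr_ge0// invf_lt1 ?ltr1n.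
have /cvgr0Pnorm_lt/(_ _ e0)[N _ hN] := cvg_expr h1.
exists N => k /hN /=; by rewrite ger0_norm// exprn_ge0// invr_ge0.
Qed.

(** Chains start at the origin, where all the maps considered agree; the
    constant [C] absorbs the size of [K]. *)
Lemma dyadic_nets (K : set X) : compact K -> exists (C : R) (N : nat -> seq X),
  [/\ 0 <= C, N 0%N = [:: 0] & forall k x, K x ->
    exists2 y, y \in N k & `|x - y| <= C * (half ^+ k) ^+ 2].
Proof.
move=> cK; have /pinfty_ex_gt0[M M0 KM] := compact_bounded cK.
have pos k : 0 < (half ^+ k) ^+ 2 by rewrite !exprn_gt0// invr_gt0.
have /choice[N NP] k := compact_net cK (pos k).
exists (Num.max 1 M), (fun k => if k is 0%N then [:: 0] else N k); split=> //.
  by rewrite le_max ler01.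
case=> [|k] x Kx.
  exists 0; first exact: mem_head.
  by rewrite subr0 expr0 expr1n mulr1 le_max (KM x Kx) orbT.
have [y Ny xy] := NP k.+1 x Kx; exists y => //.
by apply: le_trans (ltW xy) _; rewrite ler_peMl ?le_max ?lexx// ltW.
Qed.

(** Every point of [K] is the limit of a chain of net points that starts at the
    origin.  The link from level [k] to level [k + 1] is short, of order
    [(half ^+ k) ^+ 2], and there are finitely many links at each level, so the
    weights [half ^+ k] tend to [0] along the family of all links.  Errors of
    [e / 4 * half ^+ k] on the links add up to at most [e / 2] along a
    chain. *)
Theorem lipschitz_approximation (K : set X) (e : R) :
  approximation_property (lip_dual X) -> compact K -> 0 < e ->
  exists s : seq (lip_dual X * X), forall x, K x -> `|x - tensor_map s x| < e.
Proof.
move=> AP cK e0; have [C [N [C0 N0 NP]]] := dyadic_nets cK.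
have half_gt0 k : 0 < half ^+ k by rewrite exprn_gt0// invr_gt0.
pose P k := [seq ab <- [seq (a, b) | a <- N k.+1, b <- N k] |
  `|ab.1 - ab.2| <= 2 * C * (half ^+ k) ^+ 2].
pose I : choiceType := {k : nat & 'I_(size (P k))}.
pose t (i : I) := half ^+ tag i.
pose pq (i : I) := nth (0, 0) (P (tag i)) (tagged i).
have t0 i : 0 < t i by exact: half_gt0.
have t1 i : t i <= 1 by rewrite exprn_ile1 ?invr_ge0// invf_le1// ler1n.
have tnull d : 0 < d -> exists r : seq I, forall i, i \notin r -> t i < d.
  move=> /half_pow_lt[n hn].
  exists [seq (existT _ k j : I) | k <- iota 0 n, j <- enum 'I_(size (P k))] => i ir.
  apply: hn; rewrite leqNgt; apply: contra ir => ni.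
  apply/allpairsPdep; exists (tag i), (tagged i).
  by rewrite mem_iota mem_enum; split=> //; case: i ni.
have pq_le i : `|(pq i).1 - (pq i).2| <= 2 * C * t i ^+ 2.
  have : pq i \in P (tag i) by exact: mem_nth.
  by rewrite mem_filter => /andP[].
have C2 : 0 <= 2 * C by rewrite mulr_ge0.
have e4 : 0 < e / 4 by rewrite divr_gt0.
have [s sP] := approximate_increments t0 t1 tnull C2 pq_le AP e4.
exists s => x Kx; set f := tensor_map s.
have /choice[proj projP] : forall k, exists y,
    y \in N k /\ `|x - y| <= C * (half ^+ k) ^+ 2.
  by move=> k; have [y] := NP k x Kx; exists y.
have step k : `|(proj k.+1 - proj k) - (f (proj k.+1) - f (proj k))| <=
    e / 4 * half ^+ k.
  have proj_in : (proj k.+1, proj k) \in P k.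
    rewrite mem_filter /=; apply/andP; split; last first.
      by apply: allpairs_f; [exact: (projP k.+1).1|exact: (projP k).1].
    have -> : proj k.+1 - proj k = (x - proj k) - (x - proj k.+1).
      by rewrite opprB [RHS]addrC subrKA.
    apply: le_trans (ler_normB _ _) _.
    have := (projP k.+1).2; have := (projP k).2.
    have : C * (half ^+ k.+1) ^+ 2 <= C * (half ^+ k) ^+ 2.
      rewrite ler_wpM2l// lerXn2r ?nnegrE ?ltW// exprS gtr_pMl//.
      by rewrite invf_lt1// ltr1n.
    lra.
  have lt : (index (proj k.+1, proj k) (P k) < size (P k))%N by rewrite index_mem.
  by have := sP (existT _ k (Ordinal lt) : I); rewrite /pq /t /= nth_index.
have chain k : `|proj k - f (proj k)| <= e / 2 * (1 - half ^+ k).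
  elim: k => [|k IH].
    have := (projP 0%N).1; rewrite N0 inE => /eqP ->.
    by rewrite /f tensor_map0 subrr normr0 expr0 subrr mulr0.
  have -> : proj k.+1 - f (proj k.+1) =
      (proj k - f (proj k)) +
      ((proj k.+1 - proj k) - (f (proj k.+1) - f (proj k))).
    by rewrite opprD [X in _ = _ + X]addrACA -opprD [RHS]addrC subrK.
  apply: le_trans (ler_normD _ _) _.
  by have := step k; move: IH; rewrite exprS; lra.
have B0 : 0 < (tensor_lip s + 1) * C + 1.
  by rewrite ltr_wpDl// mulr_ge0// addr_ge0// tensor_lip_ge0.
have [k /(_ k (leqnn k)) hk] :=
  half_pow_lt (divr_gt0 e0 (mulr_gt0 (ltr0Sn R 1) B0)).
have -> : x - f x = (proj k - f (proj k)) + ((x - proj k) - (f x - f (proj k))).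
  by rewrite opprD [X in _ = _ + X]addrACA -opprD [RHS]addrC subrK.
have near_proj : `|(x - proj k) - (f x - f (proj k))| <=
    (tensor_lip s + 1) * C * half ^+ k.
  apply: le_trans (ler_normB _ _) _.
  apply: (@le_trans _ _ ((tensor_lip s + 1) * `|x - proj k|)).
    by rewrite mulrDl mul1r addrC lerD2r tensor_map_lip.
  rewrite -mulrA ler_wpM2l ?addr_ge0 ?tensor_lip_ge0//.
  apply: le_trans (projP k).2 _; rewrite ler_wpM2l//.
  rewrite expr2 ler_piMr ?(ltW (half_gt0 k))//.
  by rewrite exprn_ile1 ?invr_ge0// invf_le1// ler1n.
have tail : (tensor_lip s + 1) * C * half ^+ k < e / 2.
  move: hk; rewrite invfM mulrA ltr_pdivlMr// => hk; apply: le_lt_trans hk.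
  by rewrite [leRHS]mulrC ler_wpM2r ?ltW// ltrDl.
apply: le_lt_trans (ler_normD _ _) _.
have hk0 := half_gt0 k; have e2 : e / 2 * (1 - half ^+ k) <= e / 2.
  by rewrite ler_piMr ?divr_ge0 ?ltW// lerBlDr lerDl ltW.
by move: (chain k) near_proj tail e2; lra.
Qed.

End Chaining.

Theorem corollary2p6 (R : realType) (X : completeNormedModType R) :
  approximation_property (lip_dual X) -> lipschitz_approximation_property X.
Proof.
move=> AP; apply/tau_c_closureP => K e cK e0.
have [s sP] := lipschitz_approximation AP cK e0.
by exists (tensor_map s) => //; exact: tensor_map_Lip0F.
Qed.
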